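(* Let $n\ge 1$ be an integer and let $b_n\ge n-1$ be a real number. For density matrices $\rho$ on a finite-dimensional Hilbert space define $M^{(n)}(\rho;b_n)=\mathrm{Tr}\big[\rho(-\ln\rho+b_n)^n\big]-b_n^n$. Then: (1) $M^{(n)}(\cdot\,;b_n)$ is concave: $M^{(n)}(p\rho_1+(1-p)\rho_2;b_n)\ge p\,M^{(n)}(\rho_1;b_n)+(1-p)\,M^{(n)}(\rho_2;b_n)$ for all density matrices $\rho_1,\rho_2$ and all $p\in[0,1]$. (2) For bipartite pure states $|\Psi\rangle\in\mathcal H_A\otimes\mathcal H_B$, the quantity $E(|\Psi\rangle\langle\Psi|)=M^{(n)}(\mathrm{Tr}_B|\Psi\rangle\langle\Psi|;b_n)$ is a pure state entanglement monotone. (3) $M^{(n)}(\cdot\,;b_n)$ is Schur concave: if $\sigma\succ\rho$ then $M^{(n)}(\rho;b_n)\ge M^{(n)}(\sigma;b_n)$.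
   Context: All Hilbert spaces are finite-dimensional. For a density matrix $\rho$ with eigenvalues $\lambda_i$, $\mathrm{Tr}[\rho(-\ln\rho+b)^n]=\sum_i\lambda_i(-\ln\lambda_i+b)^n$, with zero eigenvalues contributing $0$. Majorization: for density matrices $\rho_1,\rho_2$ of the same dimension $d$ with eigenvalues in decreasing order $\lambda_1\ge\dots\ge\lambda_d$ and $\kappa_1\ge\dots\ge\kappa_d$, $\rho_1\succ\rho_2$ means $\sum_{k=1}^m\lambda_k\ge\sum_{k=1}^m\kappa_k$ for all $m=1,\dots,d$. A pure state entanglement monotone is a function $E$ of bipartite pure states such that $E\ge 0$, $E=0$ on product (separable) pure states, and $E$ does not increase on average under LOCC (local operations on $A$ and $B$ assisted by classical communication): if an LOCC process with Kraus operators $K_i=A_i\otimes B_i$ takes $|\Psi\rangle$ to the pure states $K_i|\Psi\rangle/\sqrt{p_i}$ with probabilities $p_i=\langle\Psi|K_i^\dagger K_i|\Psi\rangle$, then $E(|\Psi\rangle\langle\Psi|)\ge\sum_i p_i\,E\big(K_i|\Psi\rangle\langle\Psi|K_i^\dagger/p_i\big)$, where terms with $p_i=0$ are omitted. *)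

(* Defs.v *)
From mathcomp Require Import all_boot all_order all_algebra.
From mathcomp Require Import spectral.
From mathcomp Require Import complex mxtens.
From mathcomp Require Import reals exp.

Set Implicit Arguments.
Unset Strict Implicit.
Unset Printing Implicit Defensive.

Import Order.TTheory GRing.Theory Num.Theory.

Local Open Scope ring_scope.
Local Open Scope complex_scope.
Local Open Scope sesquilinear_scope.

Definition density (R : realType) (d : nat) (rho : 'M[R[i]]_d) : Prop :=
  [/\ rho \is hermsymmx,
      forall v : 'cV[R[i]]_d, 0 <= (v ^t* *m rho *m v) 0 0
    & \tr rho = 1].

(* The list of eigenvalues, with multiplicity.  It is only meant for Hermitian
   matrices, whose spectrum is real, so that taking real parts loses nothing. *)
Definition eigenvals (R : realType) (d : nat) (A : 'M[R[i]]_d) : seq R :=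
  [seq complex.Re (spectral_diag A 0 i) | i <- enum 'I_d].

(* M^(n)(rho; b) = Tr[rho (- ln rho + b)^n] - b^n.
   Zero eigenvalues contribute 0, whatever the value of ln 0. *)
Definition qmoment (R : realType) (n : nat) (b : R) (d : nat)
    (rho : 'M[R[i]]_d) : R :=
  \sum_(l <- eigenvals rho) l * (- ln l + b) ^+ n - b ^+ n.

Definition eigenvals_decr (R : realType) (d : nat) (A : 'M[R[i]]_d) : seq R :=
  sort (fun x y => y <= x) (eigenvals A).

Definition majorizes (R : realType) (d : nat) (sigma rho : 'M[R[i]]_d) : Prop :=
  forall m : nat, (1 <= m <= d)%N ->
    \sum_(k < m) (eigenvals_decr rho)`_k <= \sum_(k < m) (eigenvals_decr sigma)`_k.

(* C^dA (x) C^dB is C^(dA * dB), in the basis ordering of the Kronecker product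
   [*t] (see [mxtens_index]). *)
Definition ptraceB (R : realType) (dA dB : nat) (X : 'M[R[i]]_(dA * dB)) :
    'M[R[i]]_dA :=
  \matrix_(i, k) \sum_(j < dB) X (mxtens_index (i, j)) (mxtens_index (k, j)).

Definition unit_vector (R : realType) (d : nat) (Psi : 'cV[R[i]]_d) : Prop :=
  Psi ^t* *m Psi = 1%:M.

Definition projector (R : realType) (d : nat) (Psi : 'cV[R[i]]_d) :
    'M[R[i]]_d := Psi *m Psi ^t*.

Definition product_vector (R : realType) (dA dB : nat)
    (Psi : 'cV[R[i]]_(dA * dB)) : Prop :=
  exists (a : 'cV[R[i]]_dA) (b : 'cV[R[i]]_dB), Psi = a *t b.

(* A Kraus operator A (x) B.  The output spaces may differ from the input
   spaces, and from one outcome of a process to another. *)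
Record local_kraus (R : realType) (dA dB : nat) := LocalKraus {
  outA : nat;
  outB : nat;
  opA : 'M[R[i]]_(outA, dA);
  opB : 'M[R[i]]_(outB, dB)
}.

Definition kraus_mx (R : realType) (dA dB : nat) (K : local_kraus R dA dB) :
    'M[R[i]]_(outA K * outB K, dA * dB) := opA K *t opB K.

Definition precompA (R : realType) (dA dA' dB : nat) (A : 'M[R[i]]_(dA', dA))
    (K : local_kraus R dA' dB) : local_kraus R dA dB :=
  LocalKraus (opA K *m A) (opB K).

Definition precompB (R : realType) (dA dB dB' : nat) (B : 'M[R[i]]_(dB', dB))
    (K : local_kraus R dA dB') : local_kraus R dA dB :=
  LocalKraus (opA K) (opB K *m B).

(* [locc Ks]: Ks is the list of Kraus operators, one per sequence of outcomes,
   of a finite-round LOCC process.  Either nothing is done, or one party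
   performs a local measurement with Kraus operators A_i (sum A_i^dagger A_i = 1)
   and announces the outcome i, on which the rest of the process may depend. *)
Inductive locc (R : realType) :
    forall dA dB : nat, seq (local_kraus R dA dB) -> Prop :=
| locc_stop (dA dB : nat) :
    @locc R dA dB [:: LocalKraus 1%:M 1%:M]
| locc_A (dA dB m : nat) (dA' : 'I_m -> nat)
    (A : forall i : 'I_m, 'M[R[i]]_(dA' i, dA))
    (next : forall i : 'I_m, seq (local_kraus R (dA' i) dB)) :
    \sum_(i < m) (A i) ^t* *m A i = 1%:M ->
    (forall i : 'I_m, locc (next i)) ->
    locc (flatten [seq map (precompA (A i)) (next i) | i <- enum 'I_m])
| locc_B (dA dB m : nat) (dB' : 'I_m -> nat)
    (B : forall i : 'I_m, 'M[R[i]]_(dB' i, dB))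
    (next : forall i : 'I_m, seq (local_kraus R dA (dB' i))) :
    \sum_(i < m) (B i) ^t* *m B i = 1%:M ->
    (forall i : 'I_m, locc (next i)) ->
    locc (flatten [seq map (precompB (B i)) (next i) | i <- enum 'I_m]).

Definition outcome_prob (R : realType) (dA dB : nat) (K : local_kraus R dA dB)
    (Psi : 'cV[R[i]]_(dA * dB)) : R :=
  complex.Re ((Psi ^t* *m ((kraus_mx K) ^t* *m kraus_mx K) *m Psi) 0 0).

Definition outcome_state (R : realType) (dA dB : nat) (K : local_kraus R dA dB)
    (Psi : 'cV[R[i]]_(dA * dB)) : 'M[R[i]]_(outA K * outB K) :=
  ((outcome_prob K Psi)^-1)%:C *:
    (kraus_mx K *m projector Psi *m (kraus_mx K) ^t*).

Definition pure_entanglement_monotone (R : realType)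
    (E : forall dA dB : nat, 'M[R[i]]_(dA * dB) -> R) : Prop :=
  [/\ forall (dA dB : nat) (Psi : 'cV[R[i]]_(dA * dB)),
        unit_vector Psi -> 0 <= E dA dB (projector Psi),
      forall (dA dB : nat) (Psi : 'cV[R[i]]_(dA * dB)),
        unit_vector Psi -> product_vector Psi -> E dA dB (projector Psi) = 0
    & forall (dA dB : nat) (Ks : seq (local_kraus R dA dB))
        (Psi : 'cV[R[i]]_(dA * dB)),
        locc Ks -> unit_vector Psi ->
        \sum_(K <- Ks | outcome_prob K Psi != 0)
          outcome_prob K Psi * E (outA K) (outB K) (outcome_state K Psi)
        <= E dA dB (projector Psi)].

(* Main.v *)
Require Import Defs.
From mathcomp Require Import all_boot all_order all_algebra.
From mathcomp Require Import spectral sesquilinear.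
From mathcomp Require Import complex mxtens.
From mathcomp Require Import boolp classical_sets functions reals topology.
From mathcomp Require Import sequences normedtype derive realfun exp ring lra.

Set Implicit Arguments.
Unset Strict Implicit.
Unset Printing Implicit Defensive.

Import Order.TTheory GRing.Theory Num.Theory numFieldNormedType.Exports.

Local Open Scope classical_set_scope.
Local Open Scope ring_scope.
Local Open Scope complex_scope.
Local Open Scope sesquilinear_scope.

(** The function f(x) = x (- ln x + b)^n lies below its tangent lines on ]0, 1]
    when b >= n - 1, hence satisfies the inequalities of Jensen and of Karamata;
    the latter is Schur concavity. In an eigenbasis of C = sum_k p_k rho_k, the
    eigenvalues of C are averages, with doubly stochastic weights, of those of
    the rho_k, so Jensen's inequality gives concavity.

    For the LOCC inequality, reshape Psi into a matrix N, so that the reduced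
    state of A is N N^t*. A concave function extended homogeneously to
    unnormalized states is superadditive. A measurement of B splits N N^t* into
    the unnormalized reduced states of the outcomes; a measurement of A does the
    same with N^t* N, which has the same nonzero eigenvalues as N N^t*. The
    general case is an induction on the rounds. *)

(** * Scalar inequalities: tangent lines, Jensen, Karamata *)

(** The function [z ^+ m * expR (- z)] decreases beyond its maximum at [m]. Concretely,
    [1 + t <= expR t] at [t = (y - x) / x], raised to the power [m], has exponent
    [m%:R * (y - x) / x], at most [y - x] because [m%:R <= x]. *)
Lemma exprn_le_expR (R : realType) (m : nat) (x y : R) :
  m%:R <= x -> x <= y -> y ^+ m <= x ^+ m * expR (y - x).
Proof.
move=> mx xy; have x0 : 0 <= x by apply: le_trans mx.
move: (x0); rewrite le_eqVlt => /predU1P[xE|xgt0].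
  have -> : m = 0%N by apply/eqP; rewrite -leqn0 -(ler_nat R) (le_trans mx)// -xE.
  by rewrite !expr0 mul1r -expR0 ler_expR subr_ge0.
have -> : y ^+ m = x ^+ m * (1 + (y - x) / x) ^+ m.
  by rewrite -exprMn; congr (_ ^+ _); field; rewrite gt_eqF.
rewrite ler_wpM2l ?exprn_ge0//.
apply: (@le_trans _ _ (expR ((y - x) / x) ^+ m)).
  by rewrite lerXn2r ?nnegrE ?expR_ge0 ?expR_ge1Dx// addr_ge0// divr_ge0 ?subr_ge0.
rewrite -expRM_natl ler_expR mulrC -mulrA ler_piMr ?subr_ge0//.
by rewrite mulrC ler_pdivrMr// mul1r.
Qed.

(* At [v = u] both sides agree, and the derivative in [v] of their difference
   has the sign of [v - u]. *)
Lemma exprn_tangent (R : realType) (n : nat) (u v : R) :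
  n%:R <= u -> n%:R <= v ->
  v ^+ n.+1 <= u ^+ n.+1 + n.+1%:R * u ^+ n * (expR (v - u) - 1).
Proof.
move=> nu nv.
pose G (z : R) := n.+1%:R * u ^+ n * expR (z - u) - z ^+ n.+1.
pose G' (z : R) := n.+1%:R * (u ^+ n * expR (z - u) - z ^+ n).
have dG (z : R) : is_derive z 1 G (G' z).

  have -> : G = n.+1%:R * u ^+ n *:
      ((expR \o ((id : R -> R) - cst u)) : R -> R) - (id : R -> R) ^+ n.+1.
    by apply/funext => w; rewrite /G !fctE.
  apply: is_derive_eq.
  rewrite /GRing.scale/= /G' -mulr_natl.
  by rewrite !mulr1 subr0 mulr1 -mulrA -mulrBr.
have cG (a c : R) : {within `[a, c]%classic, continuous G}.
  apply: derivable_within_continuous => z _; exact: ex_derive.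
suff : G u <= G v.
  by rewrite /G subrr expR0; lra.
have [uv|/ltW vu] := leP u v.
  have [c] := MVT_segment uv (fun x _ => dG x) (@cG _ _).
  rewrite in_itv/= => /andP[uc cv] e.
  rewrite -subr_ge0 e mulr_ge0 ?subr_ge0// /G' mulr_ge0 ?ler0n// subr_ge0.
  exact: exprn_le_expR.
have [c] := MVT_segment vu (fun x _ => dG x) (@cG _ _).
rewrite in_itv/= => /andP[vc cu] e.
rewrite -subr_le0 e mulr_le0_ge0 ?subr_ge0// /G' pmulr_rle0 ?ltr0Sn// subr_le0.
have := exprn_le_expR (le_trans nv vc) cu.
rewrite -ler_pdivrMr ?expR_gt0// -expRN opprB.
by [].
Qed.

(* The line of slope [g x] through [(x, f x)] lies above [f]. The point [x = 0]
   is excluded because [x (- ln x + b)^n] has a vertical tangent there. *)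
Definition tangent_bound (R : realType) (f g : R -> R) : Prop :=
  forall x y : R, 0 < x <= 1 -> 0 <= y <= 1 -> f y <= f x + g x * (y - x).

(** Adding the tangent bounds at [x] and at [y] gives [0 <= (g x - g y) * (y - x)]. *)
Lemma tangent_bound_antitone (R : realType) (f g : R -> R) (x y : R) :
  tangent_bound f g -> 0 < x -> x <= y -> y <= 1 -> g y <= g x.
Proof.
move=> fg x0 xy y1; have y0 : 0 < y := lt_le_trans x0 xy.
have [->//|xney] := eqVneq x y.
have hx : 0 < x <= 1 by rewrite x0 (le_trans xy).
have hy : 0 < y <= 1 by rewrite y0.
have := fg x y hx; have := fg y x hy.
rewrite !(ltW x0) !(ltW y0) y1 (le_trans xy y1) => /(_ isT) h1 /(_ isT) h2.
rewrite -(@ler_pM2r _ (y - x)) ?subr_gt0 ?lt_neqAle ?xney//.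
by move: h1 h2; lra.
Qed.

(** Averaging the tangent bounds at the mean [z] cancels the linear terms. When [z = 0] there is no
    tangent, but every [w i * x i] vanishes and both sides are 0. *)
Lemma tangent_bound_jensen (R : realType) (f g : R -> R) (I : finType)
    (w x : I -> R) :
  f 0 = 0 -> tangent_bound f g ->
  (forall i, 0 <= w i) -> \sum_i w i = 1 -> (forall i, 0 <= x i <= 1) ->
  \sum_i w i * f (x i) <= f (\sum_i w i * x i).
Proof.
move=> f0 fg w0 w1 x01; set z := \sum_i w i * x i.
have wx0 i : 0 <= w i * x i by rewrite mulr_ge0//; case/andP: (x01 i).
have z1 : z <= 1.
  rewrite -w1 ler_sum// => i _; rewrite ler_piMr//.
  by case/andP: (x01 i).
have : 0 <= z by rewrite sumr_ge0.
rewrite le_eqVlt => /predU1P[zE|zgt0].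
  have /psumr_eq0P wxE : \sum_i w i * x i = 0 by rewrite -/z.
  rewrite -zE f0 big1// => i _.
  have /eqP := wxE (fun i _ => wx0 i) i isT.
  by rewrite mulf_eq0 => /orP[] /eqP ->; rewrite ?mul0r// f0 mulr0.
apply: (@le_trans _ _ (\sum_i w i * (f z + g z * (x i - z)))).
  by apply: ler_sum => i _; rewrite ler_wpM2l// fg// zgt0.
rewrite (eq_bigr (fun i => w i * (f z - g z * z) + g z * (w i * x i))); last first.
  by move=> i _; ring.
by rewrite big_split/= -mulr_suml w1 -mulr_sumr -/z mul1r subrK.
Qed.

(** Summation by parts: the gap is the sum of the increments of [c] times partial sums of [a], all
    nonnegative. *)
Lemma abel_sum_le (R : realType) (d : nat) (a c : nat -> R) :
  (forall m, (m <= d)%N -> 0 <= \sum_(k < m) a k) ->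
  (forall i j, (i <= j <= d)%N -> c i <= c j) ->
  \sum_(k < d.+1) c k * a k <= c d * \sum_(k < d.+1) a k.
Proof.
elim: d => [|d IH] a0 cc; first by rewrite !big_ord1.
rewrite big_ord_recr [in leRHS]big_ord_recr/= mulrDr lerD//.
apply: (le_trans (IH _ _)) => [m md|i j /andP[ij jd]|].
- by rewrite a0// leqW.
- by rewrite cc// ij leqW.
- by rewrite ler_wpM2r ?a0// cc// leqnSn leqnn.
Qed.

(** Tangents at the [t k] bound the difference of the sums by that of [g (t k) * (s k - t k)]. The
    slopes grow with [k] as [t] decreases, and the partial sums of [s - t] are nonnegative with
    total 0, so Abel summation applies. *)
Lemma tangent_bound_karamata (R : realType) (f g : R -> R) (d : nat)
    (s t : nat -> R) :
  f 0 = 0 -> tangent_bound f g ->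
  (forall k, (k < d)%N -> 0 <= s k <= 1) ->
  (forall k, (k < d)%N -> 0 <= t k <= 1) ->
  (forall i j, (i <= j < d)%N -> t j <= t i) ->
  (forall m, (m <= d)%N -> \sum_(k < m) t k <= \sum_(k < m) s k) ->
  \sum_(k < d) s k = \sum_(k < d) t k ->
  \sum_(k < d) f (s k) <= \sum_(k < d) f (t k).
Proof.
move=> f0 fg; elim: d => [|d IH] s01 t01 tdecr st st_eq; first by rewrite !big_ord0.
have : 0 <= t d by case/andP: (t01 d (leqnn _)).
rewrite le_eqVlt => /predU1P[td0|td_gt0].
  (* A zero entry of t at the end forces a zero entry of s; the tangent slope
     at 0, which need not exist, is thus never used. *)
  have sd_ge0 : 0 <= s d by case/andP: (s01 d (leqnn _)).
  move: st_eq; rewrite !big_ord_recr/= -td0 addr0 => st_eq.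
  have st_d := st d (leqnSn d).
  have sd0 : s d = 0.
    by apply/le_anti; rewrite sd_ge0 andbT -(lerD2l (\sum_(k < d) s k)) st_eq addr0.
  rewrite sd0 lerD2r; move: st_eq; rewrite sd0 addr0.
  apply: IH => [k kd|k kd|i j /andP[ij jd]|m md].
  - by rewrite s01// leqW.
  - by rewrite t01// leqW.
  - by rewrite tdecr// ij leqW.
  - by rewrite st// leqW.
have t_gt0 k : (k <= d)%N -> 0 < t k.
  by move=> kd; apply: (lt_le_trans td_gt0); rewrite tdecr// kd leqnn.
have t_le1 k : (k <= d)%N -> t k <= 1.
  by move=> kd; case/andP: (t01 k kd).
apply: (@le_trans _ _ (\sum_(k < d.+1) (f (t k) + g (t k) * (s k - t k)))).
  apply: ler_sum => k _; have kd : (k <= d)%N by rewrite -ltnS.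
  by rewrite fg ?s01// t_gt0// t_le1.
rewrite big_split/= gerDl.
apply: (le_trans (@abel_sum_le _ d (fun k => s k - t k) (g \o t) _ _)) => /=.
- by move=> m md; rewrite sumrB subr_ge0 st// leqW.
- move=> i j /andP[ij jd]; have id' := leq_trans ij jd.
  apply: (tangent_bound_antitone fg); rewrite ?t_gt0 ?t_le1//.
  by rewrite tdecr// ij ltnS.
- by rewrite sumrB st_eq subrr mulr0.
Qed.

(** With [u = - ln x + b] and [v = - ln y + b], one has [expR (v - u) = x / y], so [y] times
    [exprn_tangent] is the claim. Since [ln] is nonpositive on ]0, 1], [n%:R <= b] puts [u] and [v]
    in the range of that lemma. *)
Lemma xlogn_tangent_bound (R : realType) (n : nat) (b : R) :
  n%:R <= b ->
  tangent_bound (fun x : R => x * (- ln x + b) ^+ n.+1)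
    (fun x : R => (- ln x + b) ^+ n.+1 - n.+1%:R * (- ln x + b) ^+ n).
Proof.
move=> nb x y /andP[x0 x1] /andP[].
have uge z : 0 < z -> z <= 1 -> n%:R <= - ln z + b.
  by move=> z0 z1; rewrite -[n%:R]add0r lerD// oppr_ge0 ln_le0.
have nux := uge x x0 x1.
(* At [y = 0] the left side is 0 and the right side reduces to [x * (n.+1%:R * u ^+ n)]. *)
rewrite le_eqVlt => /predU1P[<- _|y0 y1].
  set u := - ln x + b in nux *.
  have h : 0 <= x * (n.+1%:R * u ^+ n).
    by rewrite mulr_ge0 ?(ltW x0)// mulr_ge0// exprn_ge0// (le_trans _ nux).
  rewrite mul0r (_ : _ + _ = x * (n.+1%:R * u ^+ n))//; ring.
have := exprn_tangent nux (uge y y0 y1).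
rewrite (_ : - ln y + b - (- ln x + b) = ln x - ln y); last by ring.
rewrite expRB !lnK ?posrE//.
set u := - ln x + b; set v := (_ ^+ n.+1) => h.
apply: (le_trans (ler_wpM2l (ltW y0) h)).
rewrite le_eqVlt; apply/orP; left; apply/eqP; field.
by rewrite gt_eqF.
Qed.

(** * Spectra of Hermitian matrices and density matrices *)

Lemma hermsymmxP (R : realType) (d : nat) (A : 'M[R[i]]_d) :
  reflect (A = A^t*) (A \is hermsymmx).
Proof. by apply: (iffP (is_hermitianmxP _ _ _)); rewrite expr0 scale1r. Qed.

Lemma trmxC_mul (R : realType) (m n p : nat)
    (A : 'M[R[i]]_(m, n)) (B : 'M[R[i]]_(n, p)) :
  (A *m B)^t* = B^t* *m A^t*.
Proof. by rewrite trmx_mul map_mxM. Qed.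

Definition eigval (R : realType) (d : nat) (A : 'M[R[i]]_d) (i : 'I_d) : R :=
  complex.Re (spectral_diag A 0 i).

Lemma big_eigenvals (R : realType) (d : nat) (A : 'M[R[i]]_d) (F : R -> R) :
  \sum_(l <- eigenvals A) F l = \sum_i F (eigval A i).
Proof. by rewrite big_map big_enum. Qed.

Lemma hermitian_spectralE (R : realType) (d : nat) (A : 'M[R[i]]_d) :
  A \is hermsymmx ->
  A = (spectralmx A)^t* *m diag_mx (\row_i (eigval A i)%:C) *m spectralmx A.
Proof.
move=> Ah; have /orthomx_spectralP {1}-> := hermitian_normalmx Ah.
rewrite invmx_unitary ?spectral_unitarymx//; congr (_ *m diag_mx _ *m _).
apply/rowP => i; rewrite mxE RRe_real//.
by have /mxOverP := hermitian_spectral_diag_real Ah; apply.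
Qed.

Lemma conj_diag_mxE (R : realType) (d : nat) (W : 'M[R[i]]_d) (D : 'rV[R[i]]_d) i :
  (W *m diag_mx D *m W^t*) i i = \sum_j `|W i j| ^+ 2 * D 0 j.
Proof.
rewrite mxE; apply: eq_bigr => j _.
by rewrite mul_mx_diag !mxE normCK; ring.
Qed.

Lemma unitarymx_row_norm (R : realType) (d : nat) (W : 'M[R[i]]_d) i :
  W \is unitarymx -> \sum_j `|W i j| ^+ 2 = 1.
Proof.
move=> /unitarymxP /matrixP /(_ i i); rewrite !mxE eqxx mulr1n => <-.
by apply: eq_bigr => j _; rewrite !mxE normCK.
Qed.

Lemma unitarymx_col_norm (R : realType) (d : nat) (W : 'M[R[i]]_d) j :
  W \is unitarymx -> \sum_i `|W i j| ^+ 2 = 1.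
Proof.
rewrite -trmx_unitary => /(unitarymx_row_norm j) <-.
by apply: eq_bigr => i _; rewrite mxE.
Qed.

(** The weights are the squared moduli of the entries of the unitary [W] relating the eigenbasis of
    [A] to the basis [P]; its rows and columns are unit vectors. *)
Lemma unitary_diag_mixing (R : realType) (d : nat) (P A : 'M[R[i]]_d) :
  P \is unitarymx -> A \is hermsymmx ->
  exists w : 'I_d -> 'I_d -> R,
    [/\ forall i j, 0 <= w i j, forall i, \sum_j w i j = 1,
        forall j, \sum_i w i j = 1
      & forall i, (P *m A *m P^t*) i i = (\sum_j w i j * eigval A j)%:C].
Proof.
move=> Pu Ah; pose W := P *m (spectralmx A)^t*.
have Wu : W \is unitarymx by rewrite mul_unitarymx// trmxC_unitary spectral_unitarymx.
have wC i j : (complex.Re (`|W i j| ^+ 2))%:C = `|W i j| ^+ 2.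
  by rewrite RRe_real// realX ?normr_real.
exists (fun i j => complex.Re (`|W i j| ^+ 2)); split.
- by move=> i j; rewrite -lecR wC exprn_ge0.
- move=> i; apply: complexI; rewrite rmorph_sum/= (eq_bigr _ (fun j _ => wC i j)).
  exact: unitarymx_row_norm.
- move=> j; apply: complexI; rewrite rmorph_sum/= (eq_bigr _ (fun i _ => wC i j)).
  exact: unitarymx_col_norm.
- move=> i; rewrite [in LHS](hermitian_spectralE Ah).
  have -> : P *m ((spectralmx A)^t* *m diag_mx (\row_i0 (eigval A i0)%:C) *m spectralmx A) *m P^t*
     = W *m diag_mx (\row_i0 (eigval A i0)%:C) *m W^t*.
    by rewrite trmxC_mul trmxCK !mulmxA.
  rewrite conj_diag_mxE rmorph_sum/=; apply: eq_bigr => j _.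
  by rewrite mxE rmorphM/= wC.
Qed.

Lemma eigvalE (R : realType) (d : nat) (A : 'M[R[i]]_d) i :
  A \is hermsymmx ->
  (spectralmx A *m A *m (spectralmx A)^t*) i i = (eigval A i)%:C.
Proof.
move=> Ah; have /unitarymxP Pu := spectral_unitarymx A.
rewrite [X in _ *m X *m _](hermitian_spectralE Ah) !mulmxA Pu mul1mx -mulmxA Pu.
by rewrite mulmx1 !mxE eqxx.
Qed.

Lemma mxtrace_eigval (R : realType) (d : nat) (A : 'M[R[i]]_d) :
  A \is hermsymmx -> \tr A = (\sum_i eigval A i)%:C.
Proof.
move=> Ah; have /unitarymxP/mulmx1C Pu := spectral_unitarymx A.
rewrite rmorph_sum/= -(eq_bigr _ (fun i _ => eigvalE i Ah)).
by rewrite -/(\tr _) mxtrace_mulC mulmxA Pu mul1mx.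
Qed.

Definition psdmx (R : realType) (d : nat) (A : 'M[R[i]]_d) : Prop :=
  A \is hermsymmx /\ forall v : 'cV[R[i]]_d, 0 <= (v^t* *m A *m v) 0 0.

Lemma eigval_ge0 (R : realType) (d : nat) (A : 'M[R[i]]_d) i :
  psdmx A -> 0 <= eigval A i.
Proof.
move=> [Ah A0]; rewrite -lecR -eigvalE//.
(* The test vector is the [i]-th eigenvector. *)
have := A0 ((row i (spectralmx A))^t*); rewrite trmxCK.
congr (_ <= _); rewrite -row_mul !mxE; apply: eq_bigr => j _.
by rewrite !mxE.
Qed.

Lemma density_psdmx (R : realType) (d : nat) (A : 'M[R[i]]_d) :
  density A -> psdmx A.
Proof. by case. Qed.

Lemma sum_eigval_density (R : realType) (d : nat) (A : 'M[R[i]]_d) :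
  density A -> \sum_i eigval A i = 1.
Proof. by case=> Ah _; rewrite mxtrace_eigval// => /complexI. Qed.

Lemma eigval_density (R : realType) (d : nat) (A : 'M[R[i]]_d) i :
  density A -> 0 <= eigval A i <= 1.
Proof.
move=> Ad; have A0 j : 0 <= eigval A j by apply/eigval_ge0/density_psdmx.
rewrite A0 -(sum_eigval_density Ad) (bigD1 i)//= lerDl.
by rewrite sumr_ge0.
Qed.

Lemma hermsymmx_real_comb (R : realType) (I : finType) (d : nat) (p : I -> R)
    (A : I -> 'M[R[i]]_d) :
  (forall k, p k != 0 -> A k \is hermsymmx) ->
  \sum_k (p k)%:C *: A k \is hermsymmx.
Proof.
move=> Ah; apply/hermsymmxP; rewrite raddf_sum/= (raddf_sum (map_mx _))/=.
apply: eq_bigr => k _.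
have [->|/Ah /hermsymmxP Ake] := eqVneq (p k) 0.
  by rewrite scale0r trmx0 map_mx0.
by rewrite {1}Ake linearZ/= map_mxZ; congr (_ *: _); rewrite [RHS]conjc_real.
Qed.

(** * Concavity and Schur concavity of the moment *)

Lemma qmoment_eigval (R : realType) (n : nat) (b : R) (d : nat) (A : 'M[R[i]]_d) :
  qmoment n b A = \sum_i eigval A i * (- ln (eigval A i) + b) ^+ n - b ^+ n.
Proof. by rewrite /qmoment big_eigenvals. Qed.

(** In an eigenbasis of the mixture, its eigenvalues are its diagonal entries, which are linear in
    the [rho k]; [unitary_diag_mixing] then treats each [rho k] in that basis. *)
Lemma eigval_exchange (R : realType) (I : finType) (d : nat) (p : I -> R)
    (rho : I -> 'M[R[i]]_d) :
  (forall k, p k != 0 -> rho k \is hermsymmx) ->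
  exists w : I -> 'I_d -> 'I_d -> R,
    [/\ forall k i j, 0 <= w k i j, forall k i, \sum_j w k i j = 1,
        forall k j, \sum_i w k i j = 1
      & forall i, eigval (\sum_k (p k)%:C *: rho k) i =
                  \sum_k p k * \sum_j w k i j * eigval (rho k) j].
Proof.
move=> rho_h; set C := \sum_k _.
have Ch : C \is hermsymmx by exact: hermsymmx_real_comb.
have Pu := spectral_unitarymx C.
have /choice[w wP] : forall k, exists w : 'I_d -> 'I_d -> R,
    [/\ forall i j, 0 <= w i j, forall i, \sum_j w i j = 1,
        forall j, \sum_i w i j = 1
      & p k != 0 -> forall i, (spectralmx C *m rho k *m (spectralmx C)^t*) i i =
                  (\sum_j w i j * eigval (rho k) j)%:C].
  move=> k; have [pk0|/rho_h rhokh] := eqVneq (p k) 0; last first.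
    have [w [w0 w1 w2 wE]] := unitary_diag_mixing Pu rhokh.
    by exists w.
  (* For [p k = 0] any doubly stochastic weights serve; those of [C] are at hand. *)
  have [w [w0 w1 w2 _]] := unitary_diag_mixing Pu Ch.
  by exists w.
exists w; split=> [k|k|k|i]; [by case: (wP k)..|].
apply: complexI; rewrite -eigvalE// {2}/C.
rewrite mulmx_sumr mulmx_suml summxE rmorph_sum/=; apply: eq_bigr => k _.
have [->|pk0] := eqVneq (p k) 0; first by rewrite scale0r mulmx0 mul0mx mxE mul0r.
have [_ _ _ /(_ pk0 i) wE] := wP k.
by rewrite -scalemxAr -scalemxAl mxE wE rmorphM.
Qed.

(** Jensen is applied to each eigenvalue of the mixture over pairs [(k, j)], using row sums 1;
    summing over [i] with column sums 1 restores the spectra of the [rho k]. The guard [p k != 0]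
    admits normalized outcomes of probability zero, which are zero matrices. *)
Lemma qmoment_concave (R : realType) (n : nat) (b : R) (I : finType) (d : nat)
    (p : I -> R) (rho : I -> 'M[R[i]]_d) :
  (1 <= n)%N -> n%:R - 1 <= b ->
  (forall k, 0 <= p k) -> \sum_k p k = 1 ->
  (forall k, p k != 0 -> density (rho k)) ->
  \sum_k p k * qmoment n b (rho k) <= qmoment n b (\sum_k (p k)%:C *: rho k).
Proof.
case: n => // n _; rewrite -natr1 addrK => nb p0 p1 rhod.
pose f (x : R) := x * (- ln x + b) ^+ n.+1.
have [w [w0 w1 w2 wE]] :=
  @eigval_exchange _ _ _ p rho (fun k pk => let: And3 h _ _ := rhod k pk in h).
rewrite qmoment_eigval.
under eq_bigr do rewrite qmoment_eigval mulrBr.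
rewrite big_split/= sumrN -mulr_suml p1 mul1r lerD2r.
(* The value 0 at weight zero keeps every point in [0, 1], as Jensen requires. *)
pose x (kj : I * 'I_d) := if p kj.1 == 0 then 0 else eigval (rho kj.1) kj.2.
have x01 kj : 0 <= x kj <= 1.
  by rewrite /x; case: eqVneq => [_|/rhod rd]; rewrite ?lexx ?ler01 ?eigval_density.
have jensen i : \sum_k p k * (\sum_j w k i j * f (eigval (rho k) j))
    <= f (eigval (\sum_k (p k)%:C *: rho k) i).
  rewrite wE.
  have -> : \sum_k p k * (\sum_j w k i j * f (eigval (rho k) j)) =
      \sum_kj (p kj.1 * w kj.1 i kj.2) * f (x kj).
    rewrite -(pair_bigA _ (fun k j => (p k * w k i j) * f (x (k, j))))/=.
    apply: eq_bigr => k _; rewrite mulr_sumr; apply: eq_bigr => j _.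
    by rewrite /x/= mulrA; case: eqVneq => // ->; rewrite !mul0r.
  have -> : \sum_k p k * (\sum_j w k i j * eigval (rho k) j) =
      \sum_kj (p kj.1 * w kj.1 i kj.2) * x kj.
    rewrite -(pair_bigA _ (fun k j => (p k * w k i j) * x (k, j)))/=.
    apply: eq_bigr => k _; rewrite mulr_sumr; apply: eq_bigr => j _.
    by rewrite /x/= mulrA; case: eqVneq => // ->; rewrite !mul0r.
  apply: (tangent_bound_jensen _ (xlogn_tangent_bound nb)) => //.
  - by rewrite mul0r.
  - by move=> kj; rewrite mulr_ge0.
  - rewrite -(pair_bigA _ (fun k j => p k * w k i j))/= -p1.
    by apply: eq_bigr => k _; rewrite -mulr_sumr w1 mulr1.
apply: (le_trans _ (ler_sum _ (fun i _ => jensen i))).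
rewrite exchange_big/=; apply: ler_sum => k _; rewrite -mulr_sumr exchange_big/=.
rewrite le_eqVlt; apply/orP; left; apply/eqP; congr (_ * _).
by apply: eq_bigr => j _; rewrite -mulr_suml w2 mul1r.
Qed.

Lemma qmoment_schur_concave (R : realType) (n : nat) (b : R) (d : nat)
    (sigma rho : 'M[R[i]]_d) :
  (1 <= n)%N -> n%:R - 1 <= b ->
  density sigma -> density rho -> majorizes sigma rho ->
  qmoment n b sigma <= qmoment n b rho.
Proof.
case: n => // n _; rewrite -natr1 addrK => nb sd rd sr.
pose f (x : R) := x * (- ln x + b) ^+ n.+1.
have szE (A : 'M[R[i]]_d) : size (eigenvals_decr A) = d.
  by rewrite size_sort size_map size_enum_ord.
have eigE (A : 'M[R[i]]_d) (F : R -> R) :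
    \sum_(l <- eigenvals A) F l = \sum_(k < d) F (eigenvals_decr A)`_k.
  rewrite -(perm_big _ (permEl (perm_sort (fun x y => y <= x) (eigenvals A))))/=.
  by rewrite (big_nth 0) szE big_mkord.
have eig01 (A : 'M[R[i]]_d) k : density A -> (k < d)%N -> 0 <= (eigenvals_decr A)`_k <= 1.
  move=> Ad kd; have : (eigenvals_decr A)`_k \in eigenvals A.
    by rewrite -(mem_sort (fun x y => y <= x)) mem_nth ?szE.
  by move=> /mapP[i _ ->]; exact: eigval_density.
have sum1 (A : 'M[R[i]]_d) : density A -> \sum_(k < d) (eigenvals_decr A)`_k = 1.
  by move=> Ad; rewrite -(eigE A id) big_eigenvals sum_eigval_density.
rewrite /qmoment lerD2r !(eigE _ f).
apply: (@tangent_bound_karamata _ f _ d (nth 0 (eigenvals_decr sigma))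
         (nth 0 (eigenvals_decr rho)) _ (xlogn_tangent_bound nb)).
- by rewrite /f mul0r.
- by move=> k; exact: eig01.
- by move=> k; exact: eig01.
- move=> i j /andP[ij jd].
  have := @sorted_leq_nth _ (fun x y : R => y <= x) _ _ 0 (eigenvals_decr rho).
  apply => //.
  + by move=> x y z yx zx; exact: le_trans zx yx.
  + by apply: sort_sorted => x y; exact: le_total.
  + by rewrite inE szE (leq_ltn_trans ij).
  + by rewrite inE szE.
(* Majorization starts at [m = 1]; the empty sums agree. *)
- case=> [|m] md; first by rewrite !big_ord0.
  exact: sr.
- by rewrite !sum1.
Qed.

(** * Nonzero eigenvalues of [P *m Q] and [Q *m P] *)

(* Both sides are determinants of products of the block matrix (X, P; Q, 1)
   with a triangular one. *)
Lemma char_poly_mulmxC (F : comNzRingType) (m n : nat) (P : 'M[F]_(m, n))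
    (Q : 'M[F]_(n, m)) :
  'X^n * char_poly (P *m Q) = 'X^m * char_poly (Q *m P).
Proof.
pose P' := map_mx polyC P; pose Q' := map_mx polyC Q.
pose M := block_mx 'X%:M P' Q' 1%:M.
have -> : char_poly (P *m Q) = \det M.
  have := det_mulmx M (block_mx 1%:M 0 (- Q') 1%:M).
  rewrite det_lblock !det1 !mulr1 mulmx_block !(mulmx0, mulmx1, mul1mx) add0r.
  rewrite add0r subrr det_ublock det1 mulr1 => <-.
  by rewrite /char_poly /char_poly_mx map_mxM mulmxN.
have := det_mulmx (block_mx 1%:M 0 (- Q') 'X%:M) M.
rewrite det_lblock det1 mul1r det_scalar => <-.
rewrite mulmx_block !(mulmx0, mulmx1, mul1mx, mul0mx) !addr0.
rewrite mul_mx_scalar mul_scalar_mx scalerN addNr det_ublock det_scalar.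
by rewrite /char_poly /char_poly_mx map_mxM mulNmx addrC.
Qed.

Lemma char_poly_normal (C : numClosedFieldType) (d : nat) (A : 'M[C]_d) :
  A \is normalmx -> char_poly A = \prod_i ('X - (spectral_diag A 0 i)%:P).
Proof.
move=> /orthomx_spectralP AE.
have -> : char_poly A = char_poly (diag_mx (spectral_diag A)).
  have Pu := spectral_unit A; set P := spectralmx A in AE Pu.
  set D := diag_mx _ in AE *.
  have PP : map_mx polyC (invmx P) *m map_mx polyC P = 1%:M.
    by rewrite -map_mxM mulVmx// map_mx1.
  have h : char_poly_mx A = map_mx polyC (invmx P) *m char_poly_mx D *m map_mx polyC P.
    rewrite /char_poly_mx mulmxBr mulmxBl scalar_mxC -(mulmxA _%:M) PP mulmx1 {1}AE.
    by rewrite !map_mxM.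
  rewrite /char_poly h !det_mulmx mulrC mulrA -det_mulmx.
  by rewrite (mulmx1C PP) det1 mul1r.
rewrite char_poly_trig ?diag_mx_is_trig//.
by apply: eq_bigr => i _; rewrite mxE eqxx.
Qed.

(** The characteristic polynomials agree up to powers of ['X], so the spectra padded with zeros are
    permutations of each other, and [F 0 = 0] hides the padding. *)
Lemma sum_eigval_mulmxC (R : realType) (m n : nat) (P : 'M[R[i]]_(m, n))
    (Q : 'M[R[i]]_(n, m)) (F : R -> R) :
  F 0 = 0 -> P *m Q \is hermsymmx -> Q *m P \is hermsymmx ->
  \sum_i F (eigval (P *m Q) i) = \sum_i F (eigval (Q *m P) i).
Proof.
move=> F0 PQh QPh.
have := char_poly_mulmxC P Q.
rewrite !char_poly_normal ?hermitian_normalmx//.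
pose sp d (A : 'M[R[i]]_d) := [seq spectral_diag A 0 i | i <- enum 'I_d].
have spE d (A : 'M[R[i]]_d) k : 'X^k * \prod_i ('X - (spectral_diag A 0 i)%:P) =
    \prod_(x <- nseq k 0 ++ sp d A) ('X - x%:P).
  rewrite big_cat big_map big_enum/=; congr (_ * _).
  by rewrite big_nseq polyC0 subr0 iter_mulr_1.
rewrite !spE => /prod_XsubC_eq PQ_perm.
have := perm_big (op := +%R) (x := 0 : R) (P := predT)
  (F := fun x : R[i] => F (complex.Re x)) _ PQ_perm.
have FE d (A : 'M[R[i]]_d) k : \sum_(x <- nseq k 0 ++ sp d A) F (complex.Re x) =
    \sum_i F (eigval A i).
  by rewrite big_cat big_map big_enum/= big_nseq F0 iter_addr_0 mul0rn add0r.
by rewrite !FE.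
Qed.

Lemma qmoment_mulmxC (R : realType) (k : nat) (b : R) (m n : nat)
    (P : 'M[R[i]]_(m, n)) (Q : 'M[R[i]]_(n, m)) :
  P *m Q \is hermsymmx -> Q *m P \is hermsymmx ->
  qmoment k b (P *m Q) = qmoment k b (Q *m P).
Proof.
move=> PQh QPh; rewrite !qmoment_eigval; congr (_ - _).
by apply: (sum_eigval_mulmxC (F := fun x => x * (- ln x + b) ^+ k)); rewrite ?mul0r.
Qed.

(** * Nonnegativity, and vanishing on pure states *)

Lemma qmoment_ge0 (R : realType) (n : nat) (b : R) (d : nat) (rho : 'M[R[i]]_d) :
  0 <= b -> density rho -> 0 <= qmoment n b rho.
Proof.
move=> b0 rd; rewrite qmoment_eigval subr_ge0 -[leLHS]mul1r -(sum_eigval_density rd).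
rewrite mulr_suml; apply: ler_sum => i _.
have /andP[l0 l1] := eigval_density i rd.
rewrite ler_wpM2l// lerXn2r ?nnegrE// ?lerDr ?addr_ge0// oppr_ge0 ln_le0//.
Qed.

(** Eigenvalues of an idempotent are 0 or 1, where [l * (- ln l + b) ^+ n] equals [l * b ^+ n];
    these sum to [b ^+ n]. *)
Lemma qmoment_pure (R : realType) (n : nat) (b : R) (d : nat) (rho : 'M[R[i]]_d) :
  density rho -> rho *m rho = rho -> qmoment n b rho = 0.
Proof.
move=> rd rr; have [rh _ _] := rd.
apply/eqP; rewrite qmoment_eigval subr_eq0 -[eqbRHS]mul1r -(sum_eigval_density rd).
rewrite mulr_suml; apply/eqP/eq_bigr => i _.
have /matrixP/(_ i i) : diag_mx (\row_j (eigval rho j)%:C) *m diag_mx (\row_j (eigval rho j)%:C)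
   = diag_mx (\row_j (eigval rho j)%:C).
  have /unitarymxP Pu := spectral_unitarymx rho; have Pu' := mulmx1C Pu.
  set D := diag_mx _.
  have -> : D = spectralmx rho *m rho *m (spectralmx rho)^t*.
    rewrite [X in _ = _ *m X *m _](hermitian_spectralE rh) -/D !mulmxA Pu mul1mx -mulmxA Pu.
    by rewrite mulmx1.
  by rewrite !mulmxA mulmxKtV ?spectral_unitarymx// -(mulmxA _ rho rho) rr.
rewrite mulmx_diag !mxE eqxx -rmorphM/= => /complexI /eqP.
rewrite -subr_eq0 -{3}[eigval rho i]mulr1 -mulrBr mulf_eq0 subr_eq0.
by move=> /orP[] /eqP ->; rewrite ?mul0r// ln1 oppr0 add0r.
Qed.

(** * Unnormalized states and superadditivity *)

Lemma herm_mulmxtC (R : realType) (m n : nat) (N : 'M[R[i]]_(m, n)) :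
  N *m N^t* \is hermsymmx.
Proof. by apply/hermsymmxP; rewrite trmxC_mul trmxCK. Qed.

Lemma psdmx_mulmxtC (R : realType) (m n : nat) (N : 'M[R[i]]_(m, n)) :
  psdmx (N *m N^t*).
Proof.
split=> [|v]; first exact: herm_mulmxtC.
have -> : v^t* *m (N *m N^t*) *m v = (v^t* *m N) *m (v^t* *m N)^t*.
  by rewrite trmxC_mul trmxCK !mulmxA.
by rewrite mxE sumr_ge0// => j _; rewrite !mxE -normCK exprn_ge0.
Qed.

Lemma psdmx_trace_ge0 (R : realType) (d : nat) (X : 'M[R[i]]_d) :
  psdmx X -> 0 <= complex.Re (\tr X).
Proof.
move=> Xp; have [Xh _] := Xp; rewrite mxtrace_eigval//= sumr_ge0// => i _.
exact: eigval_ge0.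
Qed.

Lemma psdmx_traceE (R : realType) (d : nat) (X : 'M[R[i]]_d) :
  psdmx X -> \tr X = (complex.Re (\tr X))%:C.
Proof. by case=> Xh _; rewrite mxtrace_eigval. Qed.

Lemma psdmx_trace0 (R : realType) (d : nat) (X : 'M[R[i]]_d) :
  psdmx X -> complex.Re (\tr X) = 0 -> X = 0.
Proof.
move=> Xp; have [Xh _] := Xp; rewrite mxtrace_eigval//= => X0.
have e0 i : eigval X i = 0.
  by apply: (psumr_eq0P _ X0) => // j _; exact: eigval_ge0.
rewrite (hermitian_spectralE Xh); set D := diag_mx _.
suff -> : D = 0 by rewrite mulmx0 mul0mx.
by apply/matrixP => i j; rewrite !mxE e0 mul0rn.
Qed.

Lemma hermsymmx_scale (R : realType) (d : nat) (c : R) (X : 'M[R[i]]_d) :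
  X \is hermsymmx -> c%:C *: X \is hermsymmx.
Proof.
move=> /hermsymmxP Xh; apply/hermsymmxP; rewrite linearZ/= map_mxZ -Xh.
by congr (_ *: _); rewrite [RHS]conjc_real.
Qed.

Lemma psdmx_density (R : realType) (d : nat) (X : 'M[R[i]]_d)
    (t := complex.Re (\tr X)) :
  psdmx X -> t != 0 -> density ((t^-1)%:C *: X).
Proof.
move=> Xp t0; have [Xh X0] := Xp; have tge0 := psdmx_trace_ge0 Xp.
split.
- exact: hermsymmx_scale.
- move=> v; rewrite -scalemxAr -scalemxAl mxE mulr_ge0//.
  by rewrite ler0c invr_ge0.
- rewrite mxtraceZ psdmx_traceE// -/t -rmorphM/= mulVf//.
Qed.

(* The homogeneous extension of qmoment to unnormalized states; it is 0 at the
   zero matrix, so that outcomes of probability zero do not contribute. *)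
Definition wmoment (R : realType) (n : nat) (b : R) (d : nat) (X : 'M[R[i]]_d) : R :=
  let t := complex.Re (\tr X) in t * qmoment n b ((t^-1)%:C *: X).

(** For [T > 0] this is [T] times the concavity inequality for the normalized [X k] with weights
    [t k / T]. A term of trace zero is the zero matrix. *)
Lemma wmoment_superadditive (R : realType) (n : nat) (b : R) (I : finType) (d : nat)
    (X : I -> 'M[R[i]]_d) :
  (1 <= n)%N -> n%:R - 1 <= b -> (forall k, psdmx (X k)) ->
  \sum_k wmoment n b (X k) <= wmoment n b (\sum_k X k).
Proof.
move=> n1 nb Xp.
pose t k := complex.Re (\tr (X k)); pose T := \sum_k t k.
have t0 k : 0 <= t k by exact: psdmx_trace_ge0.
have TE : complex.Re (\tr (\sum_k X k)) = T.
  suff -> : \tr (\sum_k X k) = T%:C by [].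
  rewrite (raddf_sum (@mxtrace _ _)) rmorph_sum/=.
  by apply: eq_bigr => k _; exact: psdmx_traceE.
have : 0 <= T by rewrite sumr_ge0.
rewrite le_eqVlt => /predU1P[T0|Tgt0].
  have tk0 k : t k = 0 by apply: (psumr_eq0P _ (esym T0)).
  by rewrite /wmoment TE -T0 mul0r big1// => k _; rewrite -/(t k) tk0 mul0r.
have Tn0 : T != 0 by rewrite gt_eqF.
have := @qmoment_concave R n b I d (fun k => t k / T) (fun k => ((t k)^-1)%:C *: X k) n1 nb.
have -> : \sum_k (t k / T)%:C *: (((t k)^-1)%:C *: X k) = (T^-1)%:C *: \sum_k X k.
  rewrite scaler_sumr; apply: eq_bigr => k _.
  have [tk0|tkn0] := eqVneq (t k) 0; first by rewrite (psdmx_trace0 (Xp k) tk0) !scaler0.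
  by rewrite scalerA -rmorphM/= mulrAC mulfV// mul1r.
rewrite /wmoment TE mulrC -ler_pdivrMr// => h.
apply: le_trans (h _ _ _).
- by rewrite mulr_suml; apply: ler_sum => k _; rewrite -/(t k) mulrAC.
- by move=> k; rewrite divr_ge0// ltW.
- by rewrite -mulr_suml mulfV.
- move=> k; rewrite mulf_eq0 invr_eq0 negb_or => /andP[tk0 _].
  exact: psdmx_density.
Qed.

Lemma wmoment_mulmxtC (R : realType) (k : nat) (b : R) (m n : nat)
    (N : 'M[R[i]]_(m, n)) :
  wmoment k b (N *m N^t*) = wmoment k b (N^t* *m N).
Proof.
rewrite /wmoment mxtrace_mulC; set t := complex.Re _; congr (_ * _).
rewrite scalemxAl qmoment_mulmxC// -?scalemxAl -?scalemxAr//; apply: hermsymmx_scale.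
  exact: herm_mulmxtC.
by rewrite -{2}[N]trmxCK herm_mulmxtC.
Qed.

(** * Amplitude matrices and LOCC processes *)

(** In this form operators of A multiply on the left, those of B on the right by their transposes,
    and product vectors have rank at most one. *)
Definition amplitude_mx (R : realType) (dA dB : nat) (Psi : 'cV[R[i]]_(dA * dB)) :
  'M[R[i]]_(dA, dB) := \matrix_(i, j) Psi (mxtens_index (i, j)) 0.

Lemma big_mxtens_index (R : realType) (m n : nat) (F : 'I_(m * n) -> R[i]) :
  \sum_k F k = \sum_i \sum_j F (mxtens_index (i, j)).
Proof.
rewrite pair_big/= (reindex (@mxtens_index m n)); last first.
  by exists (@mxtens_unindex m n) => k _; [exact: mxtens_indexK|exact: mxtens_unindexK].
by apply: eq_bigr => -[].
Qed.

Lemma ptraceB_projector (R : realType) (dA dB : nat) (Psi : 'cV[R[i]]_(dA * dB)) :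
  ptraceB (projector Psi) = amplitude_mx Psi *m (amplitude_mx Psi)^t*.
Proof.
by apply/matrixP => i k; rewrite !mxE; apply: eq_bigr => j _; rewrite !mxE big_ord1 !mxE.
Qed.

Lemma ptraceB_scale (R : realType) (dA dB : nat) (c : R[i]) (X : 'M[R[i]]_(dA * dB)) :
  ptraceB (c *: X) = c *: ptraceB X.
Proof.
by apply/matrixP => i k; rewrite !mxE mulr_sumr; apply: eq_bigr => j _; rewrite mxE.
Qed.

Lemma mxtrace_ptraceB (R : realType) (dA dB : nat) (X : 'M[R[i]]_(dA * dB)) :
  \tr (ptraceB X) = \tr X.
Proof. by rewrite /mxtrace big_mxtens_index; apply: eq_bigr => i _; rewrite mxE. Qed.

Lemma mxtrace_projector (R : realType) (d : nat) (v : 'cV[R[i]]_d) :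
  \tr (projector v) = (v^t* *m v) 0 0.
Proof. by rewrite /projector mxtrace_mulC /mxtrace big_ord1. Qed.

Lemma amplitude_mx_tens (R : realType) (m n p q : nat) (A : 'M[R[i]]_(m, n))
    (B : 'M[R[i]]_(p, q)) (Psi : 'cV[R[i]]_(n * q)) :
  amplitude_mx ((A *t B) *m Psi) = A *m amplitude_mx Psi *m B^T.
Proof.
apply/matrixP => i j; rewrite !mxE big_mxtens_index.
under [RHS]eq_bigr do rewrite !mxE mulr_suml.
rewrite exchange_big/=; apply: eq_bigr => k _; apply: eq_bigr => l _.
by rewrite tensmxE !mxE; ring.
Qed.

Lemma projector_mulmx (R : realType) (m n : nat)
    (K : 'M[R[i]]_(m, n)) (v : 'cV[R[i]]_n) :
  K *m projector v *m K^t* = projector (K *m v).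
Proof. by rewrite /projector trmxC_mul !mulmxA. Qed.

Lemma outcome_probE (R : realType) (dA dB : nat) (K : local_kraus R dA dB)
    (Psi : 'cV[R[i]]_(dA * dB)) :
  outcome_prob K Psi = complex.Re (\tr (ptraceB (projector (kraus_mx K *m Psi)))).
Proof.
rewrite mxtrace_ptraceB mxtrace_projector /outcome_prob trmxC_mul.
by rewrite !mulmxA.
Qed.

Definition pure_moment (R : realType) (n : nat) (b : R) (dA dB : nat)
  (N : 'M[R[i]]_(dA, dB)) : R := wmoment n b (N *m N^t*).

(** The probability is the trace of the unnormalized reduced state, so weighting and renormalization
    together are exactly [wmoment]. *)
Lemma outcome_moment (R : realType) (n : nat) (b : R) (dA dB : nat)
    (K : local_kraus R dA dB) (Psi : 'cV[R[i]]_(dA * dB)) :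
  outcome_prob K Psi * qmoment n b (ptraceB (outcome_state K Psi)) =
  pure_moment n b (opA K *m amplitude_mx Psi *m (opB K)^T).
Proof.
rewrite /outcome_state ptraceB_scale projector_mulmx outcome_probE.
by rewrite ptraceB_projector amplitude_mx_tens.
Qed.

Lemma pure_moment_measureB (R : realType) (n : nat) (b : R) (dA dB m : nat)
    (dB' : 'I_m -> nat)
    (B : forall i, 'M[R[i]]_(dB' i, dB)) (N : 'M[R[i]]_(dA, dB)) :
  (1 <= n)%N -> n%:R - 1 <= b -> \sum_i (B i)^t* *m B i = 1%:M ->
  \sum_i pure_moment n b (N *m (B i)^T) <= pure_moment n b N.
Proof.
move=> n_ge1 b_ge B1.
have -> : pure_moment n b N =
    wmoment n b (\sum_i (N *m (B i)^T) *m (N *m (B i)^T)^t*).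
  congr wmoment; under eq_bigr do rewrite trmxC_mul mulmxA -(mulmxA N).
  rewrite -mulmx_suml -mulmx_sumr; congr (_ *m _).
  rewrite -[LHS]mulmx1; congr (_ *m _).
  (* The factors [(B i)^T] call for the transpose of the completeness relation. *)
  rewrite -trmx1 -B1 raddf_sum/=; apply: eq_bigr => i _.
  by rewrite trmx_mul map_trmx trmxK.
by apply: wmoment_superadditive => // i; exact: psdmx_mulmxtC.
Qed.

(** Completeness of the [A i] acts between [N^t*] and [N], hence the passage to [N^t* *m N], the
    transposed reduced state of B. *)
Lemma pure_moment_measureA (R : realType) (n : nat) (b : R) (dA dB m : nat)
    (dA' : 'I_m -> nat)
    (A : forall i, 'M[R[i]]_(dA' i, dA)) (N : 'M[R[i]]_(dA, dB)) :
  (1 <= n)%N -> n%:R - 1 <= b -> \sum_i (A i)^t* *m A i = 1%:M ->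
  \sum_i pure_moment n b (A i *m N) <= pure_moment n b N.
Proof.
move=> n_ge1 b_ge A1; rewrite /pure_moment wmoment_mulmxtC.
under eq_bigr do rewrite wmoment_mulmxtC.
have -> : N^t* *m N = \sum_i (A i *m N)^t* *m (A i *m N).
  under eq_bigr do rewrite trmxC_mul mulmxA -(mulmxA (N^t*)).
  by rewrite -mulmx_suml -mulmx_sumr A1 mulmx1.
apply: wmoment_superadditive => // i.
by rewrite -{2}[A i *m N]trmxCK; exact: psdmx_mulmxtC.
Qed.

(** [N] varies in the induction: the process after outcome [i] starts from the unnormalized
    [A i *m N] or [N *m (B i)^T]. *)
Lemma pure_moment_locc (R : realType) (n : nat) (b : R) (dA dB : nat)
    (Ks : seq (local_kraus R dA dB)) (N : 'M[R[i]]_(dA, dB)) :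
  (1 <= n)%N -> n%:R - 1 <= b -> locc Ks ->
  \sum_(K <- Ks) pure_moment n b (opA K *m N *m (opB K)^T) <= pure_moment n b N.
Proof.
move=> n_ge1 b_ge KsP; elim: KsP N => {dA dB Ks} [dA dB|dA dB m dA' A next A1 _ IH|
  dA dB m dB' B next B1 _ IH] N.
- by rewrite big_seq1/= trmx1 mul1mx mulmx1.
- rewrite big_flatten big_map big_enum/=.
  apply: le_trans (pure_moment_measureA N n_ge1 b_ge A1); apply: ler_sum => i _.
  rewrite big_map/=; apply: le_trans (IH i (A i *m N)).
  by under [leLHS]eq_bigr do rewrite -[_ *m A i *m N]mulmxA.
- rewrite big_flatten big_map big_enum/=.
  apply: le_trans (pure_moment_measureB N n_ge1 b_ge B1); apply: ler_sum => i _.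
  rewrite big_map/=; apply: le_trans (IH i (N *m (B i)^T)).
  by under [leLHS]eq_bigr do rewrite trmx_mul mulmxA -(mulmxA _ N).
Qed.

Lemma unit_vector_density (R : realType) (dA dB : nat) (Psi : 'cV[R[i]]_(dA * dB)) :
  unit_vector Psi -> density (ptraceB (projector Psi)).
Proof.
move=> Psi1.
have [h1 h2] : psdmx (ptraceB (projector Psi)).
  by rewrite ptraceB_projector; exact: psdmx_mulmxtC.
by split=> //; rewrite mxtrace_ptraceB mxtrace_projector Psi1 mxE eqxx.
Qed.

(** The reduced state is a column [x] times a row [M]; trace one means [M *m x = 1], so the middle
    of the square collapses. *)
Lemma product_vector_pure (R : realType) (dA dB : nat) (Psi : 'cV[R[i]]_(dA * dB)) :
  unit_vector Psi -> product_vector Psi ->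
  ptraceB (projector Psi) *m ptraceB (projector Psi) = ptraceB (projector Psi).
Proof.
move=> Psi1 [x [y PsiE]].
have NE : amplitude_mx Psi = x *m y^T.
  apply/matrixP => i j; rewrite PsiE !mxE big_ord1 !mxE mxtens_indexK/=.
  by rewrite !ord1.
have [_ _] := unit_vector_density Psi1.
rewrite ptraceB_projector NE.
set N := x *m y^T; set M := y^T *m N^t*.
have NN : N *m N^t* = x *m M by rewrite /N /M -mulmxA.
rewrite NN mxtrace_mulC /mxtrace big_ord1 => tr1.
rewrite -mulmxA (mulmxA M) [M *m x]mx11_scalar tr1 mul1mx//.
Qed.

Theorem mainTheorem1 (R : realType) (n : nat) (b : R)
    (n_ge1 : (1 <= n)%N) (b_ge : n%:R - 1 <= b) :
  [/\ forall (d : nat) (rho1 rho2 : 'M[R[i]]_d) (p : R),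
        density rho1 -> density rho2 -> 0 <= p <= 1 ->
        p * qmoment n b rho1 + (1 - p) * qmoment n b rho2
        <= qmoment n b (p%:C *: rho1 + (1 - p)%:C *: rho2),
      pure_entanglement_monotone
        (fun (dA dB : nat) (X : 'M[R[i]]_(dA * dB)) => qmoment n b (ptraceB X))
    & forall (d : nat) (sigma rho : 'M[R[i]]_d),
        density sigma -> density rho -> majorizes sigma rho ->
        qmoment n b sigma <= qmoment n b rho].
Proof.
split.
- move=> d rho1 rho2 p d1 d2 /andP[p0 p1].
  have := @qmoment_concave R n b bool d (fun k => if k then p else 1 - p)
    (fun k => if k then rho1 else rho2) n_ge1 b_ge.
  rewrite !big_bool/=; apply.
  + by case; rewrite ?subr_ge0.
  + by rewrite addrC subrK.
  + by case.
- split=> [dA dB Psi Psi1|dA dB Psi Psi1 prod_Psi|dA dB Ks Psi KsP Psi1].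
  + apply: qmoment_ge0; last exact: unit_vector_density.
    by apply: le_trans b_ge; rewrite subr_ge0 ler1n.
  + apply: qmoment_pure; first exact: unit_vector_density.
    exact: product_vector_pure.
  + have [_ _ tr1] := unit_vector_density Psi1.
    have -> : qmoment n b (ptraceB (projector Psi)) = pure_moment n b (amplitude_mx Psi).
      by rewrite /pure_moment -ptraceB_projector /wmoment tr1/= invr1 mul1r scale1r.
    apply: le_trans (pure_moment_locc _ n_ge1 b_ge KsP).
    (* Outcomes of probability zero enter the unfiltered sum with value 0. *)
    rewrite big_mkcond/= le_eqVlt; apply/orP; left; apply/eqP.
    apply: eq_bigr => K _; rewrite -outcome_moment.
    by case: eqVneq => // ->; rewrite mul0r.
- by move=> d sigma rho; exact: qmoment_schur_concave.
Qed.
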